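(* Let $X$ and $Y$ be Banach spaces and let $(S,T)\in P(X,Y)$ be a Fredholm pair. Let $\mathcal X=X/R(TS)$, $\mathcal Y=Y/R(ST)$, and let $\overline S\in L(\mathcal X,\mathcal Y)$, $\overline T\in L(\mathcal Y,\mathcal X)$ be the operators induced by $S$ and $T$ on the quotients. Then $(S,T)$ belongs to $RP(X,Y)$ if and only if $(\overline S,\overline T)$ is a regular Fredholm symmetrical pair.
   Context: $L(X,Y)$ is the space of bounded linear operators from $X$ to $Y$; $N(\cdot)$ and $R(\cdot)$ denote null space and range. For $S\in L(X,Y)$, $T\in L(Y,X)$, the pair $(S,T)$ is a Fredholm pair, $(S,T)\in P(X,Y)$, if $N(S)/(N(S)\cap R(T))$, $R(T)/(N(S)\cap R(T))$, $N(T)/(N(T)\cap R(S))$, $R(S)/(N(T)\cap R(S))$ are all finite dimensional. It is a Fredholm symmetrical pair if moreover $ST=0$ and $TS=0$. An operator $T\in L(Y,X)$ is regular if $T=TT'T$ for some $T'\in L(X,Y)$. $RP(X,Y)$ is the set of Fredholm pairs $(S,T)$ with $S$ and $T$ regular; a regular Fredholm symmetrical pair is a Fredholm symmetrical pair whose two operators are regular. For $(S,T)\in P(X,Y)$ the subspaces $R(ST)$ and $R(TS)$ are finite dimensional, so $\mathcal X$ and $\mathcal Y$ are Banach spaces; since $S(R(TS))\subseteq R(ST)$ and $T(R(ST))\subseteq R(TS)$, the induced operators $\overline S(x+R(TS))=Sx+R(ST)$, $\overline T(y+R(ST))=Ty+R(TS)$ are well defined. *)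

(* Defs.v *)
From HB Require Import structures.
From mathcomp Require Import all_boot all_order all_algebra generic_quotient ring_quotient.
From mathcomp Require Import complex.
From mathcomp Require Import mathcomp_extra boolp classical_sets functions.
From mathcomp Require Import reals topology normedtype.
From mathcomp Require Import sequences ring.

Set Implicit Arguments.
Unset Strict Implicit.
Unset Printing Implicit Defensive.

Import Order.TTheory GRing.Theory Num.Theory.
Import numFieldNormedType.Exports.

Local Open Scope classical_set_scope.
Local Open Scope ring_scope.

(* The scalars of a Banach space: the real or the complex numbers. *)
Variant scalar_field := RealScalars of realType | ComplexScalars of realType.

Definition scalars (k : scalar_field) : numFieldType :=
  match k with
  | RealScalars R => R
  | ComplexScalars R => complex R
  end.

Lemma scalar_infimums (k : scalar_field) (A : set (scalars k)) :
  A !=set0 -> (forall a, A a -> 0 <= a) -> infimums A !=set0.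
Proof.
case: k A => R A A0 Age0 /=.
  have infA : has_inf A by split => //; exists 0.
  exists (inf A); split; first by move=> a Aa; apply: ge_inf => //; case: infA.
  by move=> d dA; apply: lb_le_inf.
pose B := [set complex.Re a | a in A].
have B0 : B !=set0 by case: A0 => a Aa; exists (complex.Re a), a.
have AB a : A a -> a = (complex.Re a)%:C%C.
  by move=> /Age0; rewrite lecE => /andP[/eqP/= Ia _]; case: a Ia => x y /= ->.
have Bge0 : lbound B 0.
  by move=> _ [a /Age0 + <-]; rewrite lecE => /andP[].
exists (inf B)%:C%C; split.
  move=> a Aa; rewrite [leRHS]AB// lecR.
  by apply: ge_inf; [exists 0 | exists a].
move=> d dA; case: A0 => a Aa.
have Id : complex.Im d = 0.
  have := dA _ Aa; rewrite lecE => /andP[/eqP <- _].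
  by rewrite (AB a Aa).
have -> : d = (complex.Re d)%:C%C by case: d Id {dA} => x y /= ->.
rewrite lecR; apply: lb_le_inf => // _ [b Ab <-].
by have := dA _ Ab; rewrite lecE => /andP[].
Qed.

Lemma complex_cauchy_cvg (R : realType)
    (F : set_system (complex R : numFieldType)) :
  ProperFilter F -> cauchy F -> exists l : (complex R : numFieldType), F --> l.
Proof.
move=> FF /cauchy_ballP FC.
pose K : numFieldType := complex R.
have cauchy_part (f : K -> R) :
    (forall x y : K, (`|f x - f y|)%:C%C <= `|x - y|) -> cvg (f @ F).
  move=> fle; apply: cauchy_cvg; apply/cauchy_ballP => e e0.
  have e0' : 0 < (e%:C%C : K) by rewrite ltcR.
  rewrite near_map2; apply: filterS (FC _ e0') => -[x y] /=.
  rewrite -!ball_normE /= => h; rewrite -ltcR; exact: le_lt_trans h.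
have /cvg_ex[a Fa] : cvg (@complex.Re R @ F).
  apply: cauchy_part => -[x1 x2] [y1 y2] /=.
  rewrite normc_def /= lecR -sqrtr_sqr; apply: ler_wsqrtr.
  by rewrite lerDl sqr_ge0.
have /cvg_ex[b Fb] : cvg (@complex.Im R @ F).
  apply: cauchy_part => -[x1 x2] [y1 y2] /=.
  rewrite normc_def /= lecR -sqrtr_sqr; apply: ler_wsqrtr.
  by rewrite lerDr sqr_ge0.
exists (Complex a b : K); apply/cvgrPdist_lt => e e0.
have [e1 e1E] : exists e1 : R, e = e1%:C%C.
  exists (complex.Re e).
  by move: e0; rewrite ltcE => /andP[/eqP /= Ie _]; case: e Ie => ? ? /= ->.
have e10 : 0 < e1 by move: e0; rewrite e1E ltcR.
have e20 : 0 < e1 / 2 by rewrite divr_gt0.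
have /cvgrPdist_lt /(_ _ e20) ha := Fa.
have /cvgrPdist_lt /(_ _ e20) hb := Fb.
near=> z.
have za : `|a - complex.Re z| < e1 / 2 by near: z.
have zb : `|b - complex.Im z| < e1 / 2 by near: z.
rewrite e1E normc_def.
have -> : Complex a b - z = Complex (a - complex.Re z) (b - complex.Im z).
  by case: (z).
rewrite /= ltcR.
apply: (@le_lt_trans _ _ (`|a - complex.Re z| + `|b - complex.Im z|)); last first.
  by rewrite [ltRHS]splitr ltrD.
rewrite -[leRHS]ger0_norm ?addr_ge0// -sqrtr_sqr; apply: ler_wsqrtr.
have sqr_le (u v : R) : u ^+ 2 + v ^+ 2 <= (`|u| + `|v|) ^+ 2.
  rewrite sqrrD !real_normK ?num_real// addrAC lerDl.
  by rewrite mulrn_wge0// mulr_ge0.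
exact: sqr_le.
Unshelve. all: by end_near. Qed.

Lemma scalar_cauchy_cvg (k : scalar_field) (F : set_system (scalars k)) :
  ProperFilter F -> cauchy F -> exists l : scalars k, F --> l.
Proof.
case: k F => R F FF FC; last exact: complex_cauchy_cvg.
by apply/cvg_ex; exact: (@R_complete R F FF FC).
Qed.

(* The quotient norm is a norm only for closed M. *)
Record closed_subspace (k : scalar_field) (X : normedModType (scalars k)) :=
  ClosedSubspace {
    subspace_set :> X -> Prop;
    subspace0 : subspace_set 0;
    subspaceP : forall (a : scalars k) x y,
      subspace_set x -> subspace_set y -> subspace_set (a *: x + y);
    subspace_closed : closed subspace_set
  }.

Section QuotientSpace.
Context (k : scalar_field) (X : normedModType (scalars k)).
Variable M : closed_subspace X.
Local Notation K := (scalars k).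

Definition subspace_pred (x : X) : bool := `[< M x >].

Let subspace_zmod_closed : zmod_closed subspace_pred.
Proof.
split; first exact/asboolP/subspace0.
move=> x y /asboolP Mx /asboolP My; apply/asboolP.
by rewrite -scaleN1r addrC; exact: subspaceP.
Qed.

Definition subspace_zmod : zmodClosed X :=
  HB.pack_for (zmodClosed X) subspace_pred
    (GRing.isZmodClosed.Build X subspace_pred subspace_zmod_closed).

Definition quotient_space : Type := Quotient.quot subspace_zmod.

HB.instance Definition _ := GRing.Zmodule.on quotient_space.

Definition coset_pi (x : X) : quotient_space := \pi_(Quotient.quot subspace_zmod)%qT x.
Definition coset_repr (q : quotient_space) : X := repr (q : Quotient.quot subspace_zmod).

Lemma coset_reprK : cancel coset_repr coset_pi.
Proof. exact: reprK. Qed.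

Lemma coset_piP x y : coset_pi x = coset_pi y <-> M (x - y).
Proof.
have -> : M (x - y) <-> (x - y) \in subspace_zmod.
  by split=> [Mxy|/asboolP//]; exact/asboolP.
by rewrite Quotient.idealrBE; split=> /eqP.
Qed.

Lemma coset_piD x y : coset_pi (x + y) = coset_pi x + coset_pi y.
Proof. exact: (@Quotient.pi_add _ subspace_zmod). Qed.

Definition coset_scale (a : K) (q : quotient_space) : quotient_space :=
  coset_pi (a *: coset_repr q).

Lemma coset_piZ a x : coset_pi (a *: x) = coset_scale a (coset_pi x).
Proof.
apply/coset_piP; rewrite -scalerBr -[_ *: _]addr0.
by apply: subspaceP (subspace0 M); apply/coset_piP; rewrite coset_reprK.
Qed.

Let coset_scaleA a b q :
  coset_scale a (coset_scale b q) = coset_scale (a * b) q.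
Proof. by rewrite -[q]coset_reprK -!coset_piZ scalerA. Qed.

Let coset_scale1 : left_id 1 coset_scale.
Proof. by move=> q; rewrite -[q]coset_reprK -coset_piZ scale1r. Qed.

Let coset_scaleDr : right_distributive coset_scale +%R.
Proof.
move=> a p q; rewrite -[p]coset_reprK -[q]coset_reprK.
by rewrite -coset_piD -!coset_piZ scalerDr coset_piD.
Qed.

Let coset_scaleDl q :
  {morph coset_scale^~ q : a b / a + b}.
Proof.
by move=> a b; rewrite -[q]coset_reprK -!coset_piZ scalerDl coset_piD.
Qed.

HB.instance Definition _ := GRing.Zmodule_isLmodule.Build K quotient_space
  coset_scaleA coset_scale1 coset_scaleDr coset_scaleDl.

Let coset_pi_linear : linear coset_pi.
Proof. by move=> a x y; rewrite coset_piD coset_piZ. Qed.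

HB.instance Definition _ :=
  GRing.isLinear.Build K X quotient_space *:%R coset_pi coset_pi_linear.

Lemma coset_pi0P x : coset_pi x = 0 <-> M x.
Proof. by rewrite -(linear0 coset_pi) coset_piP subr0. Qed.

(* The default value 0 is not used: the set is nonempty and its infimum exists
   by [scalar_infimums], also for the partial order of the complex numbers. *)
Definition coset_norm (q : quotient_space) : K :=
  infimum 0 [set `|x| | x in [set x | coset_pi x = q]].

Let coset_normP (q : quotient_space) :
  infimums [set `|x| | x in [set x | coset_pi x = q]] (coset_norm q).
Proof.
have q0 : [set `|x| | x in [set x | coset_pi x = q]] !=set0.
  by exists `|coset_repr q|, (coset_repr q) => //=; exact: coset_reprK.
rewrite /coset_norm /infimum ifF; last by apply/negbTE/set0P.
have [|d dP] := scalar_infimums q0; first by move=> _ [x _ <-].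
by case: xgetP => [_ -> //|/(_ d)].
Qed.

Lemma coset_norm_le x : coset_norm (coset_pi x) <= `|x|.
Proof. by have [+ _] := coset_normP (coset_pi x); apply; exists x. Qed.

Lemma le_coset_norm (d : K) (q : quotient_space) :
  (forall x, coset_pi x = q -> d <= `|x|) -> d <= coset_norm q.
Proof.
have [_ qglb] := coset_normP q; move=> dle; apply: qglb.
by move=> _ [x xq <-]; exact: dle.
Qed.

Let coset_norm_ge0 q : 0 <= coset_norm q.
Proof. exact: le_coset_norm. Qed.

Lemma coset_norm_lt (q : quotient_space) (e : K) :
  coset_norm q < e -> exists2 x, coset_pi x = q & `|x| < e.
Proof.
move=> qe; apply: contrapT => nex.
suff /(lt_le_trans qe) : e <= coset_norm q by rewrite ltxx.
apply: le_coset_norm => x xq; rewrite real_leNgt ?normr_real//; last first.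
  by rewrite ger0_real// (le_trans _ (ltW qe)).
by apply/negP => xe; apply: nex; exists x.
Qed.

Let coset_normD p q : coset_norm (p + q) <= coset_norm p + coset_norm q.
Proof.
rewrite -lerBlDl; apply: le_coset_norm => y <-; rewrite lerBlDl -lerBlDr.
apply: le_coset_norm => x <-; rewrite lerBlDr -coset_piD.
by rewrite (le_trans (coset_norm_le _))// ler_normD.
Qed.

Let coset_normZ a q : coset_norm (a *: q) = `|a| * coset_norm q.
Proof.
have normZ_le b p : coset_norm (b *: p) <= `|b| * coset_norm p.
  have [->|b0] := eqVneq b 0.
    rewrite scale0r normr0 mul0r -(linear0 coset_pi).
    by rewrite (le_trans (coset_norm_le _)) ?normr0.
  rewrite -ler_pdivrMl ?normr_gt0//; apply: le_coset_norm => x <-.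
  by rewrite ler_pdivrMl ?normr_gt0// -normrZ -linearZ/= coset_norm_le.
apply/le_anti; rewrite normZ_le/=.
have [->|a0] := eqVneq a 0; first by rewrite normr0 mul0r coset_norm_ge0.
rewrite -ler_pdivlMl ?normr_gt0// -normfV (le_trans _ (normZ_le _ _))//.
by rewrite scalerA mulVf// scale1r.
Qed.

Let coset_norm0_eq0 q : coset_norm q = 0 -> q = 0.
Proof.
move=> q0; rewrite -[q]coset_reprK; apply/coset_pi0P.
apply: (subspace_closed (c := M)) => U /nbhs_ballP[e /= e0 eU].
have [|x xq xe] := @coset_norm_lt q e; first by rewrite q0.
exists (coset_repr q - x); split.
  by apply/coset_pi0P; rewrite linearB /= coset_reprK xq subrr.
by apply: eU; rewrite -ball_normE /ball_/= opprB addrC subrK.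
Qed.

HB.instance Definition _ := Lmodule_isNormed.Build K quotient_space
  coset_normD coset_normZ coset_norm0_eq0.

Lemma quotient_normE (q : quotient_space) :
  `|q| = infimum 0 [set `|x| | x in [set x | coset_pi x = q]].
Proof. by []. Qed.

End QuotientSpace.

Lemma scalar_half_lt (k : scalar_field) (e : scalars k) :
  0 < e -> exists N, forall n, (N <= n)%N -> 2^-1 ^+ n < e.
Proof.
have half_lt (R : realType) (r : R) :
    0 < r -> exists N, forall n, (N <= n)%N -> 2^-1 ^+ n < r.
  have h1 : (2^-1 : R) < 1 by rewrite invf_lt1 ?ltr1n.
  have : `|2^-1 : R| < 1 by rewrite ger0_norm ?invr_ge0 ?ler0n//; exact: h1.
  move=> + r0.
  move=> /cvg_expr/cvgrPdist_lt /(_ _ r0) [N _ hN]; exists N => n /hN /=.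
  by rewrite sub0r normrN ger0_norm ?exprn_ge0 ?invr_ge0 ?ler0n.
case: k e => R e /=; first exact: half_lt.
rewrite ltcE => /andP[/eqP /= Ie /half_lt[N hN]]; exists N => n /hN.
have -> : e = (complex.Re e)%:C%C by case: e Ie {hN} => x y /= ->.
have -> : (2^-1 : complex R) = (2^-1)%:C%C.
  rewrite -[LHS]/((2%:R)^-1) -[in LHS](rmorph_nat (real_complex R)).
  by rewrite -fmorphV.
by rewrite -rmorphXn ltcR.
Qed.

Section QuotientComplete.
Context (k : scalar_field) (X : completeNormedModType (scalars k)).
Variable M : closed_subspace X.
Local Notation K := (scalars k).
Local Notation Q := (quotient_space M).

Let quotient_cauchy_cvg (F : set_system Q) :
  ProperFilter F -> cauchy F -> cvg F.
Proof.
move=> FF /cauchyP FC.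
pose h n : K := 2^-1 ^+ n.
have h0 n : 0 < h n by rewrite exprn_gt0 ?invr_gt0 ?ltr0n.
have hS n : h n.+1 + h n.+1 = h n by rewrite /h exprS -mulrDl -[2^-1]mul1r -splitr !mul1r.
have /choice[q Fq] : forall n, exists p, F (ball p (h n)) by move=> n; exact: FC.
have /choice[z zq] : forall n, exists z,
    coset_pi M z = q n.+1 - q n /\ `|z| < h n + h n.
  move=> n; have [p []] := filter_ex (filterI (Fq n) (Fq n.+1)).
  rewrite -!ball_normE /ball_/= => qn qn1.
  have [|z zE zlt] := @coset_norm_lt k X M (q n.+1 - q n) (h n + h n); last by exists z.
  rewrite -[coset_norm _]/(`|q n.+1 - q n|).
  rewrite -(subrK p (q n.+1)) -addrA (le_lt_trans (ler_normD _ _))//.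
  rewrite [`|p - _|]distrC ltrD// (lt_trans qn1)// -(hS n) ltrDl//.
pose x n := coset_repr (q 0) + \sum_(i < n) z i.
have xq n : coset_pi M (x n) = q n.
  rewrite linearD/= coset_reprK linear_sum/=.
  under eq_bigr do rewrite (zq _).1.
  by rewrite -(big_mkord xpredT (fun i => q i.+1 - q i)) telescope_sumr// addrC subrK.
have xle n m : `|x (n + m)%N - x n| <= 4 * h n - 4 * h (n + m)%N.
  elim: m => [|m IH]; first by rewrite addn0 !subrr normr0.
  have -> : x (n + m.+1)%N = x (n + m)%N + z (n + m)%N.
    by rewrite /x addnS big_ord_recr /= addrA.
  rewrite addrAC (le_trans (ler_normD _ _))// addnS.
  rewrite (le_trans (lerD IH (ltW (zq _).2)))//.
  rewrite -(hS (n + m)%N); set t := h (n + m).+1.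
  by rewrite le_eqVlt; apply/orP; left; apply/eqP; ring.
have {}xle n m : (n <= m)%N -> `|x m - x n| < 4 * h n + h n.
  move=> /subnKC <-; rewrite (le_lt_trans (xle _ _))//.
  rewrite ltrD2l (lt_trans _ (h0 _))// oppr_lt0 mulr_gt0//.
have small e : 0 < e -> exists N, forall n, (N <= n)%N -> 4 * h n + h n < e.
  move=> e0; have [|N hN] := @scalar_half_lt k (e / 5); first by rewrite divr_gt0.
  exists N => n /hN; rewrite ltr_pdivlMr// -/(h n) => /le_lt_trans; apply.
  by have -> : h n * 5 = 4 * h n + h n by ring.
have /cauchy_cvg/cvg_ex[/= l xl] : cauchy (x @ \oo).
  apply/cauchy_exP => e e0; have [N hN] := small _ e0.
  exists (x N); exists N => // n /= Nn; rewrite -ball_normE /ball_/= distrC.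
  by rewrite (lt_trans (xle _ _ Nn))// hN.
apply/cvg_ex; exists (coset_pi M l); apply/cvgrPdist_lt => e e0.
have e20 : 0 < e / 2 by rewrite divr_gt0.
have /cvgrPdist_lt /(_ _ e20) [N1 _ h1] := xl.
have [N2 h2] := small _ e20.
pose N := maxn N1 N2.
apply: filterS (Fq N) => p; rewrite -ball_normE /ball_/= => qp.
rewrite -(subrK (q N) (coset_pi M l)) -addrA (le_lt_trans (ler_normD _ _))//.
rewrite [ltRHS]splitr ltrD//.
  rewrite -xq -linearB/= (le_lt_trans (coset_norm_le _ _))//.
  by apply: h1; exact: leq_maxl.
rewrite (lt_trans qp)// (lt_trans _ (h2 N _)) ?leq_maxr// ltrDr mulr_gt0//.
Qed.

HB.instance Definition _ := Uniform_isComplete.Build Q quotient_cauchy_cvg.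

End QuotientComplete.

Record bounded_operator (k : scalar_field) (X Y : normedModType (scalars k)) :=
  BoundedOperator {
    operator :> {linear X -> Y};
    operator_bounded : bounded_near operator (nbhs (0 : X))
  }.

Notation "''L' ( X , Y )" := (bounded_operator X Y)
  (at level 8, format "''L' ( X ,  Y )") : type_scope.

Section FredholmPairs.
Context (k : scalar_field).
Local Notation K := (scalars k).

(* For subspaces W of V: the cosets of finitely many vectors of V span V / W. *)
Definition finite_dim_quotient (X : normedModType K) (V W : set X) : Prop :=
  exists n (v : 'I_n -> X), (forall i, V (v i)) /\
    forall x, V x -> exists c : 'I_n -> K, W (x - \sum_i c i *: v i).

Definition null_space (X Y : normedModType K) (S : 'L(X, Y)) : set X :=
  [set x | S x = 0].

Definition fredholm_pair (X Y : normedModType K)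
    (S : 'L(X, Y)) (T : 'L(Y, X)) : Prop :=
  [/\ finite_dim_quotient (null_space S) (null_space S `&` range T),
      finite_dim_quotient (range T) (null_space S `&` range T),
      finite_dim_quotient (null_space T) (null_space T `&` range S) &
      finite_dim_quotient (range S) (null_space T `&` range S)].

Definition fredholm_symmetrical_pair (X Y : normedModType K)
    (S : 'L(X, Y)) (T : 'L(Y, X)) : Prop :=
  [/\ fredholm_pair S T, forall y, S (T y) = 0 & forall x, T (S x) = 0].

Definition regular (X Y : normedModType K) (T : 'L(Y, X)) : Prop :=
  exists T' : 'L(X, Y), forall y, T y = T (T' (T y)).

Definition regular_fredholm_pair (X Y : normedModType K)
    (S : 'L(X, Y)) (T : 'L(Y, X)) : Prop :=
  [/\ fredholm_pair S T, regular S & regular T].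

Definition regular_fredholm_symmetrical_pair (X Y : normedModType K)
    (S : 'L(X, Y)) (T : 'L(Y, X)) : Prop :=
  [/\ fredholm_symmetrical_pair S T, regular S & regular T].

End FredholmPairs.

Section InducedOperator.
Context (k : scalar_field) (X Y : normedModType (scalars k)).
Variables (M : closed_subspace X) (N : closed_subspace Y) (A : 'L(X, Y)).
Hypothesis AMN : forall x, M x -> N (A x).

Definition induced_fun (q : quotient_space M) : quotient_space N :=
  coset_pi N (A (coset_repr q)).

Lemma induced_funE x : induced_fun (coset_pi M x) = coset_pi N (A x).
Proof.
apply/coset_piP; rewrite -linearB; apply: AMN; apply/coset_piP.
by rewrite coset_reprK.
Qed.

Let induced_linear : linear induced_fun.
Proof.
move=> a p q; rewrite -[p]coset_reprK -[q]coset_reprK -linearP !induced_funE.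
by rewrite !linearP.
Qed.

HB.instance Definition _ :=
  GRing.isLinear.Build _ _ _ _ induced_fun induced_linear.

Let induced_bounded :
  bounded_near induced_fun (nbhs (0 : quotient_space M)).
Proof.
apply/linear_boundedP; have /linear_boundedP/pinfty_ex_gt0[r r0 Ar] := operator_bounded A.
near=> s => q.
apply: (@le_trans _ _ (r * `|q|)); last first.
  by rewrite ler_wpM2r//; near: s; apply: nbhs_pinfty_ge; exact: gtr0_real.
rewrite -ler_pdivrMl//; apply: le_coset_norm => x <-.
rewrite ler_pdivrMl// [X in `|X|]induced_funE.
by rewrite (le_trans (coset_norm_le _ _)).
Unshelve. all: by end_near. Qed.

Definition induced_operator : 'L(quotient_space M, quotient_space N) :=
  BoundedOperator (operator := induced_fun) induced_bounded.

Lemma induced_operatorE x :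
  induced_operator (coset_pi M x) = coset_pi N (A x).
Proof. exact: induced_funE. Qed.

End InducedOperator.

Section FiniteDimensionalClosed.
Context (k : scalar_field).
Local Notation K := (scalars k).

Lemma line_closed (X : normedModType K) (v : X) :
  closed (range (fun a : K => a *: v)).
Proof.
have [->|v0] := eqVneq v 0.
  have -> : range (fun a : K => a *: (0 : X)) = [set 0].
    apply/seteqP; split=> [_ [a _ <-]|_ ->]; first exact: scaler0.
    by exists 0 => //; exact: scaler0.
  exact/accessible_closed_set1/hausdorff_accessible/norm_hausdorff.
move=> y yv; pose f a : X := a *: v.
pose G : set_system K := filter_from (nbhs y) (fun U => f @^-1` U).
have GP : ProperFilter G.
  apply: filter_from_proper; last by move=> U /yv[_ [[a _ <-]]]; exists a.
  apply: filter_from_filter; first by exists setT; exact: filterT.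
  move=> U V yU yV; exists (U `&` V) => //; exact: filterI.
have nv : 0 < `|v| by rewrite normr_gt0.
have [|l Gl] := @scalar_cauchy_cvg k G.
  apply/cauchy_exP => e e0; have ev : 0 < e * `|v| / 2 by rewrite divr_gt0// mulr_gt0.
  have [_ [[a _ <-] ya]] := yv _ (nbhsx_ballx y _ ev).
  exists a, (ball y (e * `|v| / 2)); first exact: nbhsx_ballx.
  move: ya; rewrite -ball_normE /ball_/= => ya.
  move=> b; rewrite /= -!ball_normE /ball_/= => yb.
  rewrite -(ltr_pM2r nv) -normrZ scalerBl.
  rewrite -(subrK y (a *: v)) -addrA (le_lt_trans (ler_normD _ _))//.
  by rewrite [ltRHS]splitr ltrD// distrC.
exists l => //.
apply: (@cvg_unique _ (@norm_hausdorff _ X) (f @ G)).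
  by apply: cvg_trans (@scalel_continuous _ _ v l); exact: cvg_app Gl.
move=> U yU; exists U => //.
Qed.

Definition span_of (X : normedModType K) n (v : 'I_n -> X) : set X :=
  range (fun c : 'I_n -> K => \sum_i c i *: v i).

Lemma span_of_linear (X : normedModType K) n (v : 'I_n -> X) (a : K) x y :
  span_of v x -> span_of v y -> span_of v (a *: x + y).
Proof.
move=> [c _ <-] [d _ <-]; exists (fun i => a * c i + d i) => //.
rewrite scaler_sumr -big_split; apply: eq_bigr => i _.
by rewrite scalerDl scalerA.
Qed.

Lemma span_of_closed (X : normedModType K) n (v : 'I_n -> X) :
  closed (span_of v).
Proof.
elim: n => [|n IHn] in v *.
  have -> : span_of v = [set 0].
    apply/seteqP; split=> [_ [c _ <-]|_ ->]; first by rewrite big_ord0.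
    by exists (fun=> 0) => //; rewrite big_ord0.
  exact/accessible_closed_set1/hausdorff_accessible/norm_hausdorff.
pose w i := v (lift ord0 i).
have w0 : span_of w 0 by exists (fun=> 0) => //; apply: big1 => i; rewrite scale0r.
pose M := ClosedSubspace w0 (@span_of_linear X n w) (IHn w).
have -> : span_of v =
    coset_pi M @^-1` (range (fun a : K => a *: coset_pi M (v ord0))).
  apply/seteqP; split=> [_ [c _ <-]|x [a _]]/=.
    exists (c ord0) => //; rewrite -linearZ; apply/coset_piP.
    rewrite big_ord_recl opprD addrA subrr add0r -sumrN /=.
    exists (fun i => - c (lift ord0 i)) => //.
    by apply: eq_bigr => i _; rewrite scaleNr.
  rewrite -linearZ => /esym/coset_piP[c _ cE].
  exists (fun i => if unlift ord0 i is Some j then c j else a) => //.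
  rewrite big_ord_recl unlift_none; under eq_bigr do rewrite liftK.
  by rewrite cE addrC subrK.
apply: preimage_closed; last exact: line_closed.
move=> x _; apply: bounded_linear_continuous.
apply/linear_boundedP; near=> r => y.
have r1 : 1 <= r by near: r; exact: nbhs_pinfty_ge.
by rewrite (le_trans (coset_norm_le _ _))// ler_peMl.
Unshelve. all: by end_near. Qed.

End FiniteDimensionalClosed.

Section FredholmQuotients.
Context (k : scalar_field) (X Y : normedModType (scalars k)).
Local Notation K := (scalars k).

Lemma range_comp_closed (S : 'L(X, Y)) (T : 'L(Y, X)) :
  finite_dim_quotient (range S) (null_space T `&` range S) ->
  closed (range (T \o S)).
Proof.
move=> [n [v [Sv vspan]]]; rewrite (_ : range _ = span_of (T \o v)).
  exact: span_of_closed.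
apply/seteqP; split=> [_ [x _ <-]|_ [c _ <-]].
  have [|c [+ _]] := vspan (S x); first by exists x.
  rewrite /null_space/= linearB/= linear_sum/= => /subr0_eq ->.
  by exists c => //; apply: eq_bigr => i _; rewrite linearZ.
have /choice[u uv] : forall i, exists u, S u = v i by move=> i; have [u _] := Sv i; exists u.
exists (\sum_i c i *: u i) => //=; rewrite !linear_sum; apply: eq_bigr => i _.
by rewrite !linearZ /= uv.
Qed.

Lemma range_comp0 (S : 'L(X, Y)) (T : 'L(Y, X)) : range (T \o S) 0.
Proof. by exists 0 => //=; rewrite !linear0. Qed.

Lemma range_comp_linear (S : 'L(X, Y)) (T : 'L(Y, X)) (a : K) x y :
  range (T \o S) x -> range (T \o S) y -> range (T \o S) (a *: x + y).
Proof. by move=> [x' _ <-] [y' _ <-]; exists (a *: x' + y') => //=; rewrite !linearP. Qed.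

End FredholmQuotients.

Section FredholmInduced.
Context (k : scalar_field) (X Y : normedModType (scalars k)).
Variables (S : 'L(X, Y)) (T : 'L(Y, X)).
Hypothesis ST : fredholm_pair S T.

Let closed_TS : closed (range (T \o S)).
Proof. by case: ST => _ _ _; exact: range_comp_closed. Qed.

Let closed_ST : closed (range (S \o T)).
Proof. by case: ST => _ + _ _; exact: range_comp_closed. Qed.

(* The subspace R(TS) = range (T \o S) of X; R(ST) = range (S \o T) of Y. *)
Definition range_TS : closed_subspace X :=
  ClosedSubspace (range_comp0 S T) (@range_comp_linear _ _ _ S T) closed_TS.

Definition range_ST : closed_subspace Y :=
  ClosedSubspace (range_comp0 T S) (@range_comp_linear _ _ _ T S) closed_ST.

Let S_range x : range_TS x -> range_ST (S x).
Proof. by move=> [u _ <-]; exists (S u). Qed.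

Let T_range y : range_ST y -> range_TS (T y).
Proof. by move=> [u _ <-]; exists (T u). Qed.

Definition induced_S : 'L(quotient_space range_TS, quotient_space range_ST) :=
  induced_operator S_range.

Definition induced_T : 'L(quotient_space range_ST, quotient_space range_TS) :=
  induced_operator T_range.

End FredholmInduced.

(* Main.v *)
From HB Require Import structures.
Require Import Defs.
From mathcomp Require Import all_boot all_order all_algebra.
From mathcomp Require Import complex.
From mathcomp Require Import boolp classical_sets reals topology normedtype.
From mathcomp Require Import ring lra.

(** The theorem compares S with the operator it induces between two quotients
by finite-dimensional subspaces M = R(TS) and N = R(ST), and such a passage
changes operators only up to finite rank.

The key fact is that regularity is insensitive to finite rank
([regular_finite_rank_defect]): if A - ABA has finite rank for some bounded B,
then A is regular.  Indeed G = A - ABA then has an inner inverse C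
([inner_inverse_on_span]), and substituting G = GCG into A = ABA + G exhibits
A as ADA with D = B + (1 - BA)C(1 - AB).

For [regular_induced], the quotient map X -> X/M has a bounded linear section
J because M is finite dimensional ([quotient_section]), and similarly for Y.
An inner inverse B of A gives the candidate y + N |-> B(L(y + N)) + M for the
induced operator, where L is a section of Y -> Y/N; an inner inverse B of the
induced operator gives the candidate y |-> J(B(y + N)) for A.  In both
directions the defect takes values in a finite-dimensional space, the image
of N under a linear map, respectively N itself.

The inner inverses of finite-rank operators and the section J both require
enough bounded functionals ([bounded_functional]), that is, the Hahn-Banach
theorem ([hahn_banach]).  It is obtained from Zorn's lemma by showing that a
minimal sublinear functional is linear; the complex case follows by restricting
scalars and setting f x = u x - i u (i x).

What remains is that the induced pair is a symmetrical Fredholm pair.  Its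
compositions vanish because R(ST) and R(TS) have been factored out, so that
the ranges lie in the null spaces; and if Sx lies in R(ST), then x lies in
N(S) + R(T), so finitely many vectors spanning N(S) modulo R(T) also span the
null space of the induced operator modulo the range of the other one. *)

Set Implicit Arguments.
Unset Strict Implicit.
Unset Printing Implicit Defensive.

Import Order.TTheory GRing.Theory Num.Theory.
Import numFieldNormedType.Exports.

Local Open Scope classical_set_scope.
Local Open Scope ring_scope.

(** * The Hahn-Banach theorem over the reals *)

Section HahnBanach.
Context (R : realType) (V : lmodType R).
Implicit Types (p q : V -> R) (x y v : V).

(** One inequality suffices for homogeneity: applied to the inverse of t it
gives the other one, see [sublinearZ]. *)
Definition sublinear p :=
  (forall x y, p (x + y) <= p x + p y) /\
  (forall (t : R) x, 0 < t -> p (t *: x) <= t * p x).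

Lemma sublinear0 p : sublinear p -> p 0 = 0.
Proof.
move=> [pD pZ]; apply/le_anti/andP; split.
  by have := pZ 2^-1 0 ltac:(by rewrite invr_gt0); rewrite scaler0; lra.
by have := pD 0 0; rewrite addr0; lra.
Qed.

Lemma sublinearZ p (t : R) x : sublinear p -> 0 <= t -> p (t *: x) = t * p x.
Proof.
move=> sp; rewrite le_eqVlt => /predU1P[<-|t0].
  by rewrite scale0r mul0r sublinear0.
apply/le_anti; rewrite sp.2//= -ler_pdivlMl//.
have := sp.2 t^-1 (t *: x); rewrite invr_gt0 scalerA mulVf ?gt_eqF// scale1r.
exact.
Qed.

Lemma sublinear_geN p x : sublinear p -> - p (- x) <= p x.
Proof.
move=> sp; have [pD _] := sp; have := pD x (- x).
by rewrite subrr (sublinear0 sp); lra.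
Qed.

(** The functional p made as linear as possible in the direction v: it is still
sublinear and below p, but already additive along the half-line of v, so that a
p that is minimal among sublinear functionals must equal its own tilts. *)
Definition tilt p v x : R :=
  inf [set p (x + t *: v) - t * p v | t in [set t : R | 0 <= t]].

Section Tilt.
Variables (p : V -> R) (v : V).
Hypothesis sp : sublinear p.

Lemma tilt_le (t : R) x : 0 <= t -> tilt p v x <= p (x + t *: v) - t * p v.
Proof.
move=> t0; apply: ge_inf; last by exists t.
exists (- p (- x)) => _ [s /= s0 <-].
have := sp.1 (x + s *: v) (- x).
by rewrite addrAC subrr add0r sublinearZ//; lra.
Qed.

Lemma le_tilt d x :
  (forall t : R, 0 <= t -> d <= p (x + t *: v) - t * p v) -> d <= tilt p v x.
Proof.
move=> dle; apply: lb_le_inf; last by move=> _ [t /= t0 <-]; exact: dle.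
by exists (p (x + 0 *: v) - 0 * p v), 0 => /=.
Qed.

Lemma tilt_le_self x : tilt p v x <= p x.
Proof. by have := tilt_le x (lexx 0); rewrite scale0r addr0 mul0r subr0. Qed.

(** Any linear f below the tilt satisfies f v >= p v. *)
Lemma tiltN : tilt p v (- v) <= - p v.
Proof.
have := tilt_le (- v) ler01.
by rewrite scale1r addNr sublinear0// mul1r add0r.
Qed.

Lemma sublinear_tilt : sublinear (tilt p v).
Proof.
split=> [x y|c x c0].
  rewrite -lerBlDl; apply: le_tilt => s s0; rewrite lerBlDl -lerBlDr.
  apply: le_tilt => t t0; rewrite lerBlDr.
  have := tilt_le (x + y) (addr_ge0 t0 s0).
  have := sp.1 (x + t *: v) (y + s *: v).
  by rewrite scalerDl addrACA; lra.
rewrite mulrC -ler_pdivrMr//; apply: le_tilt => t t0; rewrite ler_pdivrMr//.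
have := tilt_le (c *: x) (mulr_ge0 (ltW c0) t0).
have := sp.2 c (x + t *: v) c0.
by rewrite scalerDr scalerA; lra.
Qed.

End Tilt.

Definition pointwise_inf (F : set (V -> R)) x : R := inf [set q x | q in F].

Lemma pointwise_inf_le p F q x : (forall q, F q -> sublinear q /\ (forall x, q x <= p x)) ->
  F q -> pointwise_inf F x <= q x.
Proof.
move=> Fp Fq; apply: ge_inf; last by exists q.
exists (- p (- x)) => _ [r Fr <-]; have [sr rp] := Fp _ Fr.
by rewrite (le_trans _ (sublinear_geN x sr))// lerN2.
Qed.

(** Totality of F lets the larger of two members be replaced by the smaller one,
so subadditivity survives the infimum. *)
Lemma sublinear_chain p F : F !=set0 ->
  (forall q, F q -> sublinear q /\ (forall x, q x <= p x)) ->
  (forall q r, F q -> F r -> (forall x, q x <= r x) \/ (forall x, r x <= q x)) ->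
  sublinear (pointwise_inf F).
Proof.
move=> [q0 Fq0] Fp Ftot.
have le_pinf d x : (forall q, F q -> d <= q x) -> d <= pointwise_inf F x.
  move=> dle; apply: lb_le_inf; first by exists (q0 x), q0.
  by move=> _ [q Fq <-]; exact: dle.
split=> [x y|c x c0].
  rewrite -lerBlDl; apply: (le_pinf) => r Fr; rewrite lerBlDl -lerBlDr.
  apply: (le_pinf) => q Fq; rewrite lerBlDr.
  have [qr|rq] := Ftot _ _ Fq Fr.
    rewrite (le_trans (pointwise_inf_le _ Fp Fq))//.
    by rewrite (le_trans ((Fp _ Fq).1.1 _ _))// lerD2l.
  rewrite (le_trans (pointwise_inf_le _ Fp Fr))//.
  by rewrite (le_trans ((Fp _ Fr).1.1 _ _))// lerD2r.
rewrite mulrC -ler_pdivrMr//; apply: (le_pinf) => q Fq; rewrite ler_pdivrMr// mulrC.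
by rewrite (le_trans (pointwise_inf_le _ Fp Fq))//; exact: (Fp _ Fq).1.2.
Qed.

(** The infimum of a chain of sublinear functionals below p does not degenerate,
as q x >= - q (- x) >= - p (- x) bounds it from below; Zorn's lemma applies. *)
Lemma minimal_sublinear p : sublinear p -> exists q,
  [/\ sublinear q, forall x, q x <= p x &
      forall r, sublinear r -> (forall x, r x <= q x) -> r = q].
Proof.
move=> sp; pose D q := sublinear q /\ (forall x, q x <= p x).
pose below (q r : {q | D q}) := `[< forall x, sval r x <= sval q x >].
have [|r s t /asboolP rs /asboolP st|s t /asboolP st /asboolP ts|A Atot|[q [sq qp]] qmin]
    := @Zorn {q | D q} below.
- by move=> q; apply/asboolP.
- by apply/asboolP => x; exact: le_trans (rs x).
- have : sval s = sval t by apply/funext => x; apply/le_anti; rewrite ts st.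
  case: s t {st ts} => [s Ds] [t Dt] /= st; case: t / st in Dt *.
  by congr exist; exact: Prop_irrelevance.
  (* The empty chain is bounded by p itself. *)
- have [[q0 Aq0]|/set0P/negP/negPn/eqP->] := pselect (A !=set0); last first.
    by exists (exist D p (conj sp (fun=> lexx _))).
  pose F : set (V -> R) := [set sval q | q in A].
  have Fp q : F q -> D q by move=> [r _ <-]; exact: svalP.
  have sF : sublinear (pointwise_inf F).
    apply: (@sublinear_chain p); first by exists (sval q0), q0.
      exact: Fp.
    move=> _ _ [q Aq <-] [r Ar <-].
    by have [/asboolP|/asboolP] := Atot _ _ Aq Ar; [right|left].
  have Fle q x : F q -> pointwise_inf F x <= q x.
    exact: pointwise_inf_le Fp.
  have DF : D (pointwise_inf F).
    split=> // x; have F0 : F (sval q0) by exists q0.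
    by rewrite (le_trans (Fle _ _ F0))//; exact: (Fp _ F0).2.
  exists (exist D _ DF) => s As; apply/asboolP => x /=.
  by apply: Fle; exists s.
- exists q; split=> // r sr rq.
  have Dr : D r by split=> // x; exact: le_trans (rq x) _.
  by have /(congr1 sval) := qmin (exist D r Dr) ltac:(exact/asboolP).
Qed.

(** A sublinear q that is minimal below the tilt of p along v equals all its own
tilts, which makes it additive, hence linear; starting from the tilt instead of
p forces f v = p v. *)
Theorem hahn_banach p v : sublinear p -> exists f : {scalar V},
  (forall x, f x <= p x) /\ f v = p v.
Proof.
move=> sp; have st := sublinear_tilt v sp.
have [q [sq qle qmin]] := minimal_sublinear st.
have tiltE a : tilt q a = q.
  by apply: qmin; [exact: sublinear_tilt | exact: tilt_le_self].
have qD x y : q (x + y) = q x + q y.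
  apply/le_anti; rewrite sq.1/=; have := tilt_le y sq x ler01.
  by rewrite tiltE scale1r mul1r; lra.
have qN x : q (- x) = - q x.
  by have := qD x (- x); rewrite subrr sublinear0//; lra.
have qZpos t x : 0 < t -> q (t *: x) = t * q x.
  move=> t0; apply/le_anti; rewrite sq.2//=.
  by have := sq.2 t (- x) t0; rewrite scalerN !qN; lra.
have qZ t x : q (t *: x) = t * q x.
  have [t0|t0|<-] := ltgtP 0 t; [exact: qZpos | | by rewrite scale0r mul0r sublinear0].
  have := qZpos (- t) x ltac:(by rewrite oppr_gt0).
  by rewrite scaleNr qN; lra.
have qlin : scalar q by move=> t x y; rewrite qD qZ.
pose f : {scalar V} := HB.pack q (GRing.isLinear.Build _ _ _ _ q qlin).
exists f; split=> [x|]; first exact: le_trans (qle x) (tilt_le_self _ sp _).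
apply/le_anti/andP; split; first exact: le_trans (qle v) (tilt_le_self _ sp _).
by have := le_trans (qle (- v)) (tiltN v sp); rewrite qN lerN2.
Qed.

End HahnBanach.

(** * Bounded functionals over the real or complex scalars *)

(** A complex space with its scalars restricted to the reals; the alias keeps the
two module structures apart. *)
Section Realification.
Context (R : realType) (V : lmodType (complex R)).

Definition realification : Type := V.

HB.instance Definition _ := GRing.Zmodule.on realification.

Definition real_scale (t : R) (x : realification) : realification :=
  t%:C%C *: (x : V).

Let real_scaleA a b x : real_scale a (real_scale b x) = real_scale (a * b) x.
Proof. by rewrite /real_scale scalerA rmorphM. Qed.

Let real_scale1 : left_id 1 real_scale.
Proof. by move=> x; rewrite /real_scale rmorph1 scale1r. Qed.

Let real_scaleDr : right_distributive real_scale +%R.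
Proof. by move=> a x y; exact: scalerDr. Qed.

Let real_scaleDl x : {morph real_scale^~ x : a b / a + b}.
Proof. by move=> a b; rewrite /real_scale rmorphD scalerDl. Qed.

HB.instance Definition _ := GRing.Zmodule_isLmodule.Build R realification
  real_scaleA real_scale1 real_scaleDr real_scaleDl.

Lemma real_scaleE (t : R) (x : realification) : t *: x = t%:C%C *: (x : V).
Proof. by []. Qed.

End Realification.

Section Functionals.

Let functional_neq0_real (R : realType) (X : normedModType R) (v : X) :
  v != 0 -> exists f : {scalar X},
    (exists2 C, 0 <= C & forall x, `|f x| <= C * `|x|) /\ f v != 0.
Proof.
move=> v0; have [|f [fle fv]] := @hahn_banach R X (fun x => `|x|) v.
  split=> [x y|t x t0]; first exact: ler_normD.
  by rewrite normrZ gtr0_norm.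
exists f; split; last by rewrite fv normr_eq0.
exists 1 => // x; rewrite mul1r ler_norml fle andbT.
by have := fle (- x); rewrite linearN normrN lerNl.
Qed.

(** A real functional u below the norm is the real part of the complex-linear
functional x |-> u x - i u (i x). *)
Let functional_neq0_complex (R : realType) (X : normedModType (complex R)) (v : X) :
  v != 0 -> exists f : {scalar X},
    (exists2 C, 0 <= C & forall x, `|f x| <= C * `|x|) /\ f v != 0.
Proof.
move=> v0; pose p (x : realification X) : R := complex.Re `|x : X|.
have pE (x : X) : `|x| = (p x)%:C%C.
  by have := normr_ge0 x; rewrite lecE /p; case: `|x| => a b /= /andP[/eqP -> _].
have [|u [ule uv]] := @hahn_banach R (realification X) p v.
  split=> [x y|t x t0].
    by rewrite -lecR rmorphD /= -!pE; exact: ler_normD.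
  rewrite -lecR rmorphM /= -!pE real_scaleE normrZ gtr0_norm//.
  by rewrite ltcR.
have uabs (x : X) : `|(u x)%:C%C| <= `|x|.
  rewrite normc_def/= expr0n addr0 sqrtr_sqr pE lecR ler_norml ule andbT.
  have := ule (- x : realification X).
  by rewrite linearN /= lerNl /p normrN.
have uD x y : u ((x : X) + y) = u x + u y by exact: linearD.
have uZ (t : R) (x : X) : u (t%:C%C *: x) = t * u x by exact: linearZ.
pose f (x : X) : complex R := (u x)%:C%C - 'i%C * (u ('i%C *: x))%:C%C.
have fD x y : f (x + y) = f x + f y.
  by rewrite /f scalerDr !uD !rmorphD/=; ring.
have ui (x : X) : u ('i%C *: ('i%C *: x)) = - u x.
  rewrite scalerA -expr2 sqr_i scaleN1r; exact: linearN.
have fi (x : X) : f ('i%C *: x) = 'i%C * f x.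
  by rewrite /f ui rmorphN/= mulrBr mulrA -expr2 sqr_i mulN1r mulrN !opprK addrC.
have fr (t : R) (x : X) : f (t%:C%C *: x) = t%:C%C * f x.
  rewrite /f scalerA ['i%C * t%:C%C]mulrC -scalerA !uZ !rmorphM/=; ring.
have flin : scalar f.
  move=> a x y; rewrite fD; congr (_ + _).
  rewrite [a]complexE scalerDl fD fr -scalerA fi fr; ring.
pose F : {scalar X} := HB.pack f (GRing.isLinear.Build _ _ _ _ f flin).
exists F; split.
  exists 2 => // x; rewrite /F /= /f (le_trans (ler_normB _ _))//.
  rewrite mulr2n mulrDl mul1r lerD// normrM.
  have i1 : `|'i%C : complex R| = 1.
    by rewrite normc_def/= expr0n expr1n add0r sqrtr1.
  by rewrite i1 mul1r (le_trans (uabs _))// normrZ i1 mul1r.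
have : complex.Re (F v) = p v.
  by rewrite /F/= /f/= uv; ring.
apply: contra_eqN => /eqP ->.
by apply/eqP => /(congr1 (real_complex R))/= /esym/eqP; rewrite -pE normr_eq0 (negbTE v0).
Qed.

Lemma bounded_functional (k : scalar_field) (X : normedModType (scalars k)) (v : X) :
  v != 0 -> exists f : {scalar X},
    (exists2 C, 0 <= C & forall x, `|f x| <= C * `|x|) /\ f v = 1.
Proof.
move=> v0; suff [f [[C C0 fC] fv]] : exists f : {scalar X},
    (exists2 C, 0 <= C & forall x, `|f x| <= C * `|x|) /\ f v != 0.
  pose g x := (f v)^-1 * f x.
  have glin : scalar g by move=> a x y; rewrite /g linearP/= mulrDr mulrCA.
  pose G : {scalar X} := HB.pack g (GRing.isLinear.Build _ _ _ _ g glin).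
  exists G; split; last by rewrite /G/= /g mulVf.
  exists (`|(f v)^-1| * C); first exact: mulr_ge0.
  by move=> x; rewrite /G/= /g normrM -mulrA ler_wpM2l.
case: k X v v0 => R X v v0; first exact: functional_neq0_real.
exact: functional_neq0_complex.
Qed.

End Functionals.

(** * Bounded linear maps *)

Section BoundedLinear.
Context (k : scalar_field).
Local Notation K := (scalars k).
Implicit Types X Y Z : normedModType K.

(** Boundedness of a bare function, from which operators are rebuilt by
[operator_of_bounded_linear]: inner inverses can then be written as plain
expressions. *)
Definition bounded_linear X Y (f : X -> Y) : Prop :=
  linear f /\ exists2 C : K, 0 <= C & forall x, `|f x| <= C * `|x|.

Section LinearTheory.
Variables (X Y : normedModType K) (f : X -> Y).
Hypothesis bf : bounded_linear f.

Let F : {linear X -> Y} := HB.pack f (GRing.isLinear.Build _ _ _ _ f bf.1).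

Lemma blinear0 : f 0 = 0. Proof. exact: (linear0 F). Qed.

Lemma blinearD x y : f (x + y) = f x + f y. Proof. exact: (linearD F). Qed.

Lemma blinearB x y : f (x - y) = f x - f y. Proof. exact: (linearB F). Qed.

Lemma blinearZ a x : f (a *: x) = a *: f x. Proof. exact: (linearZZ F). Qed.

Lemma blinear_sum n (c : 'I_n -> K) (v : 'I_n -> X) :
  f (\sum_i c i *: v i) = \sum_i c i *: f (v i).
Proof.
by rewrite [LHS](linear_sum F); apply: eq_bigr => i _; exact: blinearZ.
Qed.

End LinearTheory.

Lemma bounded_linear_operator X Y (A : 'L(X, Y)) : bounded_linear A.
Proof.
split; first exact: linearP.
have /linear_boundedP/pinfty_ex_gt0[r r0 Ar] := operator_bounded A.
by exists r; [exact: ltW | exact: Ar].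
Qed.

Lemma operator_of_bounded_linear X Y (f : X -> Y) :
  bounded_linear f -> exists A : 'L(X, Y), forall x, A x = f x.
Proof.
move=> [flin [C C0 fC]].
pose F : {linear X -> Y} := HB.pack f (GRing.isLinear.Build _ _ _ _ f flin).
have Fb : bounded_near F (nbhs (0 : X)).
  apply/linear_boundedP; near=> r => x.
  rewrite (le_trans (fC x))// ler_wpM2r//.
  by near: r; apply: nbhs_pinfty_ge; exact: ger0_real.
by exists (BoundedOperator Fb).
Unshelve. all: by end_near. Qed.

Lemma bounded_linear0 X Y : bounded_linear (fun _ : X => 0 : Y).
Proof.
split=> [a x y|]; first by rewrite scaler0 addr0.
by exists 0 => // x; rewrite normr0 mul0r.
Qed.

Lemma bounded_linearD X Y (f g : X -> Y) : bounded_linear f ->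
  bounded_linear g -> bounded_linear (fun x => f x + g x).
Proof.
move=> [fl [C C0 fC]] [gl [D D0 gD]]; split=> [a x y|].
  by rewrite fl gl scalerDr addrACA.
exists (C + D) => [|x]; first exact: addr_ge0.
by rewrite (le_trans (ler_normD _ _))// mulrDl lerD.
Qed.

Lemma bounded_linear_comp X Y Z (g : Y -> Z) (f : X -> Y) : bounded_linear g ->
  bounded_linear f -> bounded_linear (fun x => g (f x)).
Proof.
move=> [gl [D D0 gD]] [fl [C C0 fC]]; split=> [a x y|].
  by rewrite fl gl.
exists (D * C) => [|x]; first exact: mulr_ge0.
by rewrite (le_trans (gD _))// -mulrA ler_wpM2l.
Qed.

Lemma bounded_linear_id X : bounded_linear (@id X).
Proof. by split=> //; exists 1 => // x; rewrite mul1r. Qed.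

Lemma bounded_linear_scalar X Y (f : {scalar X}) (y : Y) :
  (exists2 C : K, 0 <= C & forall x, `|f x| <= C * `|x|) ->
  bounded_linear (fun x => f x *: y).
Proof.
move=> [C C0 fC]; split=> [a u v|].
  by rewrite linearP scalerDl scalerA.
exists (C * `|y|) => [|x]; first exact: mulr_ge0.
by rewrite normrZ mulrAC ler_wpM2r.
Qed.

Lemma bounded_linearN X Y (f : X -> Y) :
  bounded_linear f -> bounded_linear (fun x => - f x).
Proof.
move=> [fl [C C0 fC]]; split=> [a x y|].
  by rewrite fl opprD scalerN.
by exists C => // x; rewrite normrN.
Qed.

Lemma bounded_linearB X Y (f g : X -> Y) : bounded_linear f ->
  bounded_linear g -> bounded_linear (fun x => f x - g x).
Proof. by move=> bf /bounded_linearN; exact: bounded_linearD. Qed.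

Lemma bounded_linear_coset_pi X (M : closed_subspace X) :
  bounded_linear (coset_pi M).
Proof.
split; first exact: linearP.
by exists 1 => // x; rewrite mul1r; exact: coset_norm_le.
Qed.

(** The bound passes to the quotient because the norm of a coset is the infimum
of the norms of its members. *)
Lemma bounded_linear_quotient X Z (M : closed_subspace X) (f : X -> Z) :
  bounded_linear f -> (forall x, M x -> f x = 0) ->
  exists g : quotient_space M -> Z,
    bounded_linear g /\ forall x, g (coset_pi M x) = f x.
Proof.
move=> bf fM; have [fl [C C0 fC]] := bf.
have gE x : f (coset_repr (coset_pi M x)) = f x.
  apply/eqP; rewrite -subr_eq0; apply/eqP; rewrite -(blinearB bf).
  by apply: fM; apply/coset_piP; rewrite coset_reprK.
exists (fun q => f (coset_repr q)); split=> //; split=> [a p q|].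
  rewrite -[p]coset_reprK -[q]coset_reprK -linearP !gE; exact: fl.
exists C => // q; rewrite -[q]coset_reprK gE.
have [Cz|Cn0] := eqVneq C 0.
  by rewrite (le_trans (fC _))// Cz !mul0r.
have Cp : 0 < C by rewrite lt_neqAle eq_sym Cn0.
rewrite -ler_pdivrMl//; apply: le_coset_norm => x xq.
by rewrite ler_pdivrMl// -gE -xq gE.
Qed.

End BoundedLinear.

(** * Spans of finite families *)

Section Spans.
Context (k : scalar_field) (X : normedModType (scalars k)).
Local Notation K := (scalars k).

Lemma span_of_cons n (v : 'I_n.+1 -> X) x : span_of v x <->
  exists a : K, span_of (fun i => v (lift ord0 i)) (x - a *: v ord0).
Proof.
split=> [[c _ <-]|[a [c _ cE]]].
  exists (c ord0); rewrite big_ord_recl addrAC subrr add0r.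
  by exists (fun i => c (lift ord0 i)).
exists (fun i => if unlift ord0 i is Some j then c j else a) => //.
rewrite big_ord_recl unlift_none; under eq_bigr do rewrite liftK.
by rewrite cE addrC subrK.
Qed.

Lemma subspace_sum (V : set X) n (v : 'I_n -> X) (c : 'I_n -> K) : V 0 ->
  (forall (a : K) x y, V x -> V y -> V (a *: x + y)) ->
  (forall i, V (v i)) -> V (\sum_i c i *: v i).
Proof.
move=> V0 Vlin Vv; apply: (big_rec V) => // i x _ Vx; exact: Vlin.
Qed.

(** Induction on n: if V is not inside the span of the last n vectors, one x0 in V
with a nonzero coefficient d on the first vector reduces the other elements of V
to that smaller span. *)
Lemma subspace_of_span (V : set X) n (v : 'I_n -> X) : V 0 ->
  (forall (a : K) x y, V x -> V y -> V (a *: x + y)) ->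
  V `<=` span_of v ->
  exists m (w : 'I_m -> X), (forall i, V (w i)) /\ V `<=` span_of w.
Proof.
elim: n => [|n IH] in V v * => V0 Vlin Vv.
  exists 0%N, v; split=> //; by case.
pose v' i := v (lift ord0 i).
have v'0 : span_of v' 0.
  by exists (fun=> 0) => //; rewrite big1// => i _; rewrite scale0r.
have [m [w [w_in wP]]] : exists m (w : 'I_m -> X),
    (forall i, (V `&` span_of v') (w i)) /\ V `&` span_of v' `<=` span_of w.
  apply: (IH _ v') => // [a x y [Vx v'x] [Vy v'y]].
  by split; [exact: Vlin | exact: span_of_linear].
have [Vv'|] := pselect (V `<=` span_of v').
  exists m, w; split=> [i|x Vx]; first by case: (w_in i).
  by apply: wP; split=> //; exact: Vv'.
move=> /existsNP[x0 /not_implyP[Vx0 v'x0]].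
have /span_of_cons[d dx0] := Vv _ Vx0.
have d0 : d != 0.
  by apply: contra_notN v'x0 => /eqP d0; move: dx0; rewrite d0 scale0r subr0.
exists m.+1, (fun i => if unlift ord0 i is Some j then w j else x0); split.
  by move=> i; case: unlift => // j; case: (w_in j).
move=> x Vx; have /span_of_cons[c cx] := Vv _ Vx.
apply/span_of_cons; exists (c / d); rewrite unlift_none.
rewrite (_ : (fun i => _) = w); last by apply/funext => i; rewrite liftK.
apply: wP; split; first by rewrite addrC -scaleNr; exact: Vlin.
have := span_of_linear (- (c / d)) dx0 cx.
by rewrite scalerBr scalerA mulNr divfK// !scaleNr opprK addrACA subrr addr0 addrC.
Qed.

End Spans.

(** * Regularity and finite-rank perturbations *)

Section Regularity.
Context (k : scalar_field).
Local Notation K := (scalars k).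
Implicit Types X Y Z : normedModType K.

(** Induction on n: if AC fixes the images of the other vectors, it misses A (u 0)
by A w, and a functional with value 1 at A w that is composed with 1 - AC
vanishes on the images already treated, so a rank-one term corrects C.  For A the
identity, C is a projection onto the span of u. *)
Lemma inner_inverse_on_span X Y (A : X -> Y) n (u : 'I_n -> X) :
  bounded_linear A -> exists C : Y -> X,
    [/\ bounded_linear C, forall y, span_of u (C y) &
        forall i, A (C (A (u i))) = A (u i)].
Proof.
move=> bA; elim: n => [|n IH] in u *.
  exists (fun=> 0); split; [exact: bounded_linear0| |by case].
  by move=> _; exists (fun=> 0) => //; rewrite big_ord0.
have [C [bC Cspan CA]] := IH (fun i => u (lift ord0 i)).
pose w := u ord0 - C (A (u ord0)).
have AwE : A w = A (u ord0) - A (C (A (u ord0))) by exact: blinearB.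
have Cspan' y : span_of u (C y).
  by apply/span_of_cons; exists 0; rewrite scale0r subr0.
have [Aw0|Aw0] := eqVneq (A w) 0.
  exists C; split=> // i; have [j|] := unliftP ord0 i => -> //.
  by apply/eqP; rewrite eq_sym -subr_eq0 -AwE Aw0.
have [f [fb fw]] := bounded_functional Aw0.
exists (fun y => C y + f (y - A (C y)) *: w); split.
- apply: bounded_linearD => //.
  apply: (bounded_linear_comp (g := fun y => f y *: w)).
    exact: bounded_linear_scalar.
  apply: bounded_linearB; first exact: bounded_linear_id.
  exact: bounded_linear_comp.
- move=> y; rewrite addrC; apply: span_of_linear => //; apply/span_of_cons.
  exists 1; rewrite scale1r /w addrAC subrr add0r -scaleN1r -[_ *: _]addr0.
  apply: span_of_linear => //.
  by exists (fun=> 0) => //; rewrite big1// => i _; rewrite scale0r.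
move=> i; rewrite (blinearD bA) (blinearZ bA).
have [j|] := unliftP ord0 i => ->.
  by rewrite !CA subrr linear0 scale0r addr0.
by rewrite -AwE fw scale1r AwE addrC subrK.
Qed.

Lemma regularP X Y (A : 'L(X, Y)) :
  regular A <-> exists2 B : Y -> X, bounded_linear B & forall x, A x = A (B (A x)).
Proof.
split=> [[B AB]|[B bB AB]]; first by exists B => //; exact: bounded_linear_operator.
have [B' B'E] := operator_of_bounded_linear bB.
by exists B' => x; rewrite B'E.
Qed.

(** With G = A - ABA = GCG, the inner inverse of A is
B + (1 - BA)C(1 - AB); below, D stands for C(1 - AB). *)
Lemma regular_finite_rank_defect X Y (A : 'L(X, Y)) (B : Y -> X) n (v : 'I_n -> Y) :
  bounded_linear B -> (forall x, span_of v (A x - A (B (A x)))) -> regular A.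
Proof.
move=> bB defect; have bA := bounded_linear_operator A.
pose G x := A x - A (B (A x)).
have bG : bounded_linear G.
  apply: bounded_linearB => //; apply: (bounded_linear_comp bA).
  exact: bounded_linear_comp.
have [|||m [w [wG Gw]]] := @subspace_of_span k Y (range G) n v.
- by exists 0 => //; exact: blinear0 bG.
- by move=> a _ _ [x _ <-] [y _ <-]; exists (a *: x + y) => //; exact: bG.1.
- by move=> _ [x _ <-]; exact: defect.
have /choice[u uw] : forall i, exists x, G x = w i.
  by move=> i; have [x _] := wG i; exists x.
have [C [bC _ GCu]] := inner_inverse_on_span u bG.
have GCG x : G (C (G x)) = G x.
  have [|c _ <-] := Gw (G x); first by exists x.
  by rewrite (blinear_sum bC) (blinear_sum bG); apply: eq_bigr => i _; rewrite -uw GCu.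
have bdefect : bounded_linear (fun y => y - A (B y)).
  apply: bounded_linearB; first exact: bounded_linear_id.
  exact: bounded_linear_comp.
pose D y := C (y - A (B y)).
have bD : bounded_linear D by exact: bounded_linear_comp.
apply/regularP; exists (fun y => B y + (D y - B (A (D y)))).
  apply: bounded_linearD => //; apply: bounded_linearB => //.
  by apply: (bounded_linear_comp bB); exact: bounded_linear_comp.
move=> x; rewrite linearD linearB -/(G (D (A x))) GCG.
by rewrite addrC subrK.
Qed.

(** The section maps x + M to x - P x for a bounded projection P onto M. *)
Lemma quotient_section X (M : closed_subspace X) n (v : 'I_n -> X) :
  M `<=` span_of v -> exists J : quotient_space M -> X,
    bounded_linear J /\ cancel J (coset_pi M).
Proof.
move=> Mv; have [||m [w [wM Mw]]] := subspace_of_span _ _ Mv.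
- exact: subspace0.
- by move=> a x y; exact: subspaceP.
have [P [bP Pw Pid]] := inner_inverse_on_span w (bounded_linear_id X).
have [||J [bJ JE]] := @bounded_linear_quotient k X X M (fun x => x - P x).
- apply: bounded_linearB => //; exact: bounded_linear_id.
- move=> x /Mw[c _ <-]; apply/eqP; rewrite subr_eq0 eq_sym; apply/eqP.
  by rewrite (blinear_sum bP); apply: eq_bigr => i _; congr (_ *: _); exact: Pid.
exists J; split=> // q; rewrite -[q]coset_reprK JE.
apply/coset_piP; rewrite addrAC subrr add0r -scaleN1r -[_ *: _]addr0.
apply: subspaceP (subspace0 M); have [c _ <-] := Pw (coset_repr q).
by apply: (subspace_sum (V := M)) => //; [exact: subspace0 | move=> ???; exact: subspaceP].
Qed.

(** Sections of the two quotient maps carry an inner inverse across the quotients;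
since a section misses a vector only by an element of N, what results is an inner
inverse up to finite rank. *)
Lemma regular_induced X Y (A : 'L(X, Y)) (M : closed_subspace X)
    (N : closed_subspace Y) (AMN : forall x, M x -> N (A x))
    m (v : 'I_m -> X) n (w : 'I_n -> Y) :
  M `<=` span_of v -> N `<=` span_of w ->
  regular A <-> regular (induced_operator AMN).
Proof.
move=> Mv Nw; have bA := bounded_linear_operator A.
have [J [bJ JK]] := quotient_section Mv; have [L [bL LK]] := quotient_section Nw.
split=> [/regularP[B bB AB]|/regularP[B bB AB]].
  (* At x + M, the defect is E n for the n in N by which the section misses
     A x. *)
  pose E y := coset_pi N (A (B y)).
  have bE : bounded_linear E.
    apply: (bounded_linear_comp (bounded_linear_coset_pi N)).
    exact: bounded_linear_comp.
  apply: (@regular_finite_rank_defect _ _ _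
    (fun q => coset_pi M (B (L q))) n (fun i => E (w i))).
    apply: (bounded_linear_comp (bounded_linear_coset_pi M)).
    exact: bounded_linear_comp.
  move=> q; rewrite -[q]coset_reprK !induced_operatorE.
  set y := A _; have [c _ cE] : span_of w (y - L (coset_pi N y)).
    by apply: Nw; apply/coset_piP; rewrite LK.
  exists c => //.
  transitivity (E (y - L (coset_pi N y))); last first.
    by rewrite (blinearB bE) /E -AB.
  by rewrite -cE (blinear_sum bE).
(* The defect vanishes modulo N because B inverts the induced operator. *)
apply: (@regular_finite_rank_defect _ _ _ (fun y => J (B (coset_pi N y))) n w).
  apply: (bounded_linear_comp bJ); apply: (bounded_linear_comp bB).
  exact: bounded_linear_coset_pi.
move=> x; apply: Nw; apply/coset_piP.
by rewrite -[RHS](induced_operatorE AMN) JK -(induced_operatorE AMN) -AB.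
Qed.

End Regularity.

(** * The induced pair *)

Section Symmetrization.
Context (k : scalar_field) (X Y : normedModType (scalars k)).
Variables (S : 'L(X, Y)) (T : 'L(Y, X)).

(** T kills R(S) modulo finitely many vectors v i, so the T (v i) span R(TS). *)
Lemma range_comp_span :
  finite_dim_quotient (range S) (null_space T `&` range S) ->
  exists n (v : 'I_n -> X), range (T \o S) `<=` span_of v.
Proof.
move=> [n [v [_ vspan]]]; exists n, (T \o v) => _ [x _ <-].
have [|c [+ _]] := vspan (S x); first by exists x.
rewrite /null_space/= linearB linear_sum => /subr0_eq ->.
by exists c => //; apply: eq_bigr => i _; rewrite linearZ.
Qed.

Variables (M : closed_subspace X) (N : closed_subspace Y).
Hypotheses (SMN : forall x, M x -> N (S x)) (TNM : forall y, N y -> M (T y)).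
Hypothesis NE : forall y, N y <-> range (S \o T) y.
Let S_ := induced_operator SMN.
Let T_ := induced_operator TNM.

Lemma induced_comp0 q : S_ (T_ q) = 0.
Proof.
rewrite -[q]coset_reprK /S_ /T_ !induced_operatorE; apply/coset_pi0P/NE.
by exists (coset_repr q).
Qed.

(** If S x = S (T u), then x - T u lies in N(S); hence modulo M the null space of
the induced operator is the image of N(S) + R(T). *)
Lemma induced_null_space_mod_range :
  finite_dim_quotient (null_space S) (null_space S `&` range T) ->
  finite_dim_quotient (null_space S_) (null_space S_ `&` range T_).
Proof.
move=> [n [v [Sv vspan]]]; exists n, (fun i => coset_pi M (v i)); split.
  by move=> i; rewrite /null_space/= (induced_operatorE SMN) (Sv i : S _ = 0) linear0.
move=> q; rewrite /null_space/= -[q]coset_reprK; set x := coset_repr q.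
rewrite (induced_operatorE SMN) => /coset_pi0P/NE[u _ /= STu].
have [|c [_ [z _ zE]]] := vspan (x - T u).
  by rewrite /null_space/= linearB STu subrr.
exists c; have -> : coset_pi M x - \sum_i c i *: coset_pi M (v i)
    = T_ (coset_pi N (z + u)).
  rewrite (induced_operatorE TNM) linearD zE addrAC subrK.
  have bpi := bounded_linear_coset_pi M.
  by rewrite (blinearB bpi) (blinear_sum bpi).
by split; [exact: induced_comp0 | exists (coset_pi N (z + u))].
Qed.

(** The range is contained in the null space, by [induced_comp0]. *)
Lemma induced_range_mod_null_space :
  finite_dim_quotient (range T_) (null_space S_ `&` range T_).
Proof.
exists 0%N, (fun=> 0); split; first by case.
move=> _ [q _ <-]; exists (fun=> 0); rewrite big_ord0 subr0.
by split; [exact: induced_comp0 | exists q].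
Qed.

End Symmetrization.

Theorem theorem5p2 (k : scalar_field) (X Y : completeNormedModType (scalars k))
    (S : 'L(X, Y)) (T : 'L(Y, X)) (ST : fredholm_pair S T) :
  regular_fredholm_pair S T <->
  regular_fredholm_symmetrical_pair (induced_S ST) (induced_T ST).
Proof.
have [fST fTS fTS' fST'] := ST.
have [m [v Mv]] := range_comp_span fST'.
have [n [w Nw]] := range_comp_span fTS.
have sym : fredholm_symmetrical_pair (induced_S ST) (induced_T ST).
  split; [split| |]; try exact: induced_comp0.
  - exact: induced_null_space_mod_range.
  - exact: induced_range_mod_null_space.
  - exact: induced_null_space_mod_range.
  - exact: induced_range_mod_null_space.
have rS : regular S <-> regular (induced_S ST) by
  exact: (@regular_induced k X Y S (range_TS ST) (range_ST ST) _ m v n w).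
have rT : regular T <-> regular (induced_T ST) by
  exact: (@regular_induced k Y X T (range_ST ST) (range_TS ST) _ n w m v).
by split=> [[_ /rS ? /rT ?]|[_ /rS ? /rT ?]]; split.
Qed.
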